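(* There exists $N$ such that for every $n \ge N$ there exists an oriented triangle-free graph $D$ of order $n$ with $\vec \alpha(D) \leq \frac{107}{8} \sqrt n \log_2 n$. Consequently $\vec a(n) \leq \frac{107}{8} \sqrt n \log_2 n$ for all sufficiently large $n$.
   Context: An oriented triangle-free graph is an oriented graph (a digraph with no loops and at most one arc between any two vertices) whose underlying undirected graph contains no triangle. The acyclic number $\vec\alpha(D)$ of a digraph $D$ is the maximum order of an induced subdigraph of $D$ that contains no directed cycle. $\vec a(n)$ denotes the minimum of $\vec\alpha(D)$ over all oriented triangle-free graphs $D$ of order $n$. *)

(* Defs.v *)
From mathcomp Require Import all_boot all_order all_algebra.
From mathcomp Require Import boolp reals exp.

Set Implicit Arguments.
Unset Strict Implicit.
Unset Printing Implicit Defensive.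

(* A digraph on the finite vertex set T is its arc relation A : rel T. *)

Section Digraphs.
Variables (T : finType) (A : rel T).

Definition oriented : Prop :=
  irreflexive A /\ (forall x y, ~~ (A x y && A y x)).

Definition adjacent : rel T := [rel x y | A x y || A y x].

(* For loopless A, pairwise adjacent vertices are automatically distinct. *)
Definition triangle_free : Prop :=
  forall x y z, ~~ [&& adjacent x y, adjacent y z & adjacent z x].

Definition oriented_triangle_free : Prop := oriented /\ triangle_free.

(* ucycle also accepts the empty sequence, which is not a directed cycle. *)
Definition acyclic : Prop := forall c : seq T, c <> [::] -> ~ ucycle A c.

Definition induced (S : {set T}) : rel {x : T | x \in S} := relpre val A.

End Digraphs.

Definition acyclic_number (T : finType) (A : rel T) : nat :=
  \max_(S : {set T} | `[< acyclic (induced A (S := S)) >]) #|S|.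

Definition acyclic_number_of_order (n m : nat) : Prop :=
  exists (T : finType) (A : rel T),
    [/\ #|T| = n, oriented_triangle_free A & acyclic_number A = m].

Lemma acyclic_number_of_order_ex (n : nat) :
  exists m, `[< acyclic_number_of_order n m >].
Proof.
exists (acyclic_number [rel x y : 'I_n | false]); apply/asboolP.
by exists 'I_n, [rel x y | false]; split=> //; rewrite card_ord.
Qed.

Definition min_acyclic_number (n : nat) : nat :=
  ex_minn (acyclic_number_of_order_ex n).

Local Open Scope ring_scope.

Definition log2 (R : realType) (x : R) : R := ln x / ln 2.

(* Main.v *)
From mathcomp Require Import sequences.
Require Import Defs.
From mathcomp Require Import all_boot all_order all_algebra.
From mathcomp Require Import boolp reals exp.
From mathcomp Require Import ring lra.

Set Implicit Arguments.
Unset Strict Implicit.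
Unset Printing Implicit Defensive.

Import Order.TTheory GRing.Theory Num.Theory.

(** Colour every pair of vertices at random: it carries an arc of either
    orientation with probability 1/Q each, where Q is about 5 sqrt n.  Deleting
    all arcs covered by a maximal edge-disjoint family of triangles leaves an
    oriented triangle-free graph.  If k of its vertices induce an acyclic digraph,
    list them in a topological order; the arcs of the random digraph among them
    that go backward all lie in the family P of deleted triangles with an edge
    inside the list.  For given order and P this has probability at most
    (1 - 1/Q)^C(k,2) (2/(Q-1))^(3 #|P|), so summing over P and over the orders gives
      n^k (1 - 1/Q)^C(k,2) (1 + (2/(Q-1))^3)^(n C(k,2))
       <= exp (k ln n - C(k,2) (1/Q - 8 n / (Q-1)^3)),
    which is below 1 as soon as k > (107/8) sqrt n log_2 n. *)

(** * Topological orders of acyclic digraphs *)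

Section TopologicalOrder.
Variables (T : finType) (A : rel T).

Lemma acyclic_connect x y : acyclic A -> A x y -> ~~ connect A y x.
Proof.
move=> acyA Axy; apply/negP=> /connectP[p pth lst].
move: Axy; rewrite {}lst; case/shortenP: pth => p' pth' Up' _ Axy.
apply: (acyA (y :: p')) => //; rewrite /ucycle /= rcons_path pth' Axy /=.
by rewrite -[_ && _]/(uniq (y :: p')) Up'.
Qed.

(** Sort by decreasing number of reachable vertices. Along an arc the reachable set strictly
    shrinks, because the tail cannot be reached back from the head. *)
Lemma acyclic_order_full : acyclic A ->
  exists s : seq T, [/\ uniq s, size s = #|T| &
     pairwise [rel x y | ~~ A y x] s].
Proof.
move=> acyA; pose h x := #|connect A x|.
have hlt x y : A x y -> h y < h x.
  move=> Axy; apply: proper_card; apply/properP; split.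
    by apply/subsetP=> z; rewrite !inE; apply: connect_trans (connect1 Axy).
  by exists x; rewrite !inE ?connect0 // acyclic_connect.
pose le := [rel x y | h y <= h x].
exists (sort le (enum T)); split.
- by rewrite sort_uniq enum_uniq.
- by rewrite size_sort -cardE.
have tr : transitive le by move=> y x z /= yx zy; apply: leq_trans yx.
have /(sort_sorted (leT := le)) : total le by move=> x y; apply: leq_total.
move=> /(_ (enum T)); rewrite sorted_pairwise //.
apply: sub_pairwise => x y /=; rewrite leqNgt; apply: contra.
exact: hlt.
Qed.

End TopologicalOrder.

(** Keeping only the first [k] entries of a topological order leaves at most [n ^ k] enumerations
    for the union bound. *)
Lemma acyclic_order (T : finType) (A : rel T) (S : {set T}) k :
  acyclic (induced A (S := S)) -> k <= #|S| ->
  exists2 f : {ffun 'I_k -> T}, injective f &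
    forall i j : 'I_k, i < j -> ~~ A (f j) (f i).
Proof.
move=> /acyclic_order_full[s [Us ss /pairwiseP ord]] kS.
have ks : k <= size s by rewrite ss card_sig.
pose g i := tnth (in_tuple s) (widen_ord ks i).
exists [ffun i => val (g i)] => [i j|i j ij]; rewrite !ffunE /g.
  move/val_inj; rewrite !(tnth_nth (g i)) => /eqP.
  rewrite nth_uniq //= ?(leq_trans (ltn_ord _) ks) // => /eqP; exact: ord_inj.
rewrite !(tnth_nth (g i)) /=.
by apply: (ord (g i) i j); rewrite ?inE ?(leq_trans (ltn_ord _) ks).
Qed.

(** * Triples, their pairs, and a sum over subsets *)

Lemma card_set3 (T : finType) (x y z : T) : x != y -> y != z -> z != x ->
  #|[set x; y; z]| = 3.
Proof.
by move=> xy yz zx; rewrite setUC cardsU1 cards2 xy !inE (negbTE zx) eq_sym yz.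
Qed.

Lemma pair_sub_set3 (T : finType) (x y z : T) (e : {set T}) :
  e \subset [set x; y; z] -> #|e| = 2 ->
  [\/ e = [set x; y], e = [set y; z] | e = [set z; x]].
Proof.
move=> sub /eqP/cards2P[a [b [ab E]]]; move: sub ab; rewrite {}E subUset !sub1set.
rewrite !inE -!orbA => /andP[/or3P[]/eqP-> /or3P[]/eqP->]; rewrite ?eqxx //= => _;
  first [ by constructor 1 | by constructor 2 | by constructor 3
        | by constructor 1; rewrite setUC | by constructor 2; rewrite setUC
        | by constructor 3; rewrite setUC ].
Qed.

(** Expand the product over all [i] of [x_i + 1], with [x_i = x] on [X] and [0] elsewhere: only
    subsets of [X] survive. *)
Lemma sum_expr_card_subsets (R : comNzRingType) (T : finType) (X : {set T}) (x : R) :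
  (\sum_(J : {set T} | J \subset X) x ^+ #|J| = (1 + x) ^+ #|X|)%R.
Proof.
have := @bigA_distr R 0%R 1%R *%R +%R T
  (fun i => if i \in X then x else 0%R) (fun=> 1%R).
rewrite (eq_bigr (fun i => if i \in X then 1 + x else 1)%R) => [|i _]; last first.
  by case: ifP => _; [exact: addrC | exact: add0r].
rewrite -big_mkcond prodr_const /= => ->.
rewrite [RHS](bigID (fun J : {set T} => J \subset X)) /= [X in (_ + X)%R]big1 ?addr0.
  apply: eq_bigr => J /subsetP JX; rewrite -prodr_const big_mkcond /=.
  by apply: eq_bigr => i _; case: ifP => // /JX ->.
move=> J /subsetPn[i iJ iX].
by rewrite (bigD1 i) //= iJ (negbTE iX) mul0r.
Qed.

(** * Random colourings and the deletion of packed triangles *)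

Section Model.
Variables (n m : nat).
Local Notation V := 'I_n.

(* On a pair of vertices, [inl true] is an arc from the smaller to the larger one,
   [inl false] the opposite arc, and [inr _] no arc: under uniform colours each of
   the two arcs has probability 1/(m+2). *)
Definition colour := (bool + 'I_m)%type.
Definition colouring := {ffun {set V} -> colour}.
Definition present (c : colour) := if c is inl _ then true else false.

Implicit Types (w : colouring) (P : {set {set V}}) (t e S : {set V}).

Definition arc w : rel V :=
  [rel x y | (x != y) && (w [set x; y] == inl (x < y))].
Definition triangle w t :=
  (#|t| == 3) && [forall (e : {set V} | (e \subset t) && (#|e| == 2)), present (w e)].
Definition edge_disjoint P :=
  [forall t1 in P, forall t2 in P, (t1 != t2) ==> (#|t1 :&: t2| <= 1)].
Definition packing w P := edge_disjoint P && [forall t in P, triangle w t].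
Definition covered P e := (#|e| == 2) && [exists t in P, e \subset t].
Definition pruned w P : rel V :=
  [rel x y | arc w x y && ~~ covered P [set x; y]].

Lemma edge_disjointP P : reflect
  {in P &, forall t1 t2, t1 != t2 -> #|t1 :&: t2| <= 1} (edge_disjoint P).
Proof.
apply: (iffP forall_inP) => [H t1 t2 P1 P2 d|H t1 P1].
  by have /forall_inP/(_ t2 P2)/implyP := H t1 P1; apply.
by apply/forall_inP => t2 P2; apply/implyP; apply: H.
Qed.

Lemma adjacent_pruned w P x y : adjacent (pruned w P) x y ->
  [/\ x != y, present (w [set x; y]) & ~~ covered P [set x; y]].
Proof.
case/orP=> /andP[/andP[xy /eqP wE] cov].
  by rewrite wE.
by rewrite eq_sym xy setUC wE.
Qed.

Lemma oriented_pruned w P : oriented (pruned w P).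
Proof.
split=> [x|x y]; first by rewrite /pruned /arc /= eqxx.
apply/negP=> /andP[/andP[/andP[xy /eqP w1] _] /andP[/andP[_ /eqP w2] _]].
move: w1; rewrite setUC w2 => -[]; case: ltngtP => // /ord_inj yx.
by rewrite yx eqxx in xy.
Qed.

(** A surviving triangle has no covered pair, so it meets each member of [P] in at most one vertex.
    By maximality it then belongs to [P], yet it meets itself in three vertices. *)
Lemma triangle_free_pruned w P :
  maxset (packing w) P -> triangle_free (pruned w P).
Proof.
case/maxsetP=> /andP[/edge_disjointP disjP /forall_inP triP] maxP x y z.
apply/negP=> /and3P[/adjacent_pruned[xy pxy cxy]
  /adjacent_pruned[yz pyz cyz] /adjacent_pruned[zx pzx czx]].
pose t := [set x; y; z].
have ct : #|t| = 3 by apply: card_set3.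
have ncov e : e \subset t -> #|e| == 2 -> ~~ covered P e.
  by move=> et /eqP ce; case: (pair_sub_set3 et ce) => ->.
have small t' : t' \in P -> #|t :&: t'| <= 1.
  move=> Pt'; rewrite leqNgt; apply/negP => big.
  have [e] : exists e : {set V}, e \in [set B in powerset (t :&: t') | #|B| == 2].
    apply/set0Pn; rewrite -card_gt0.
    have -> : [set B in powerset (t :&: t') | #|B| == 2]
      = [set B : {set V} | (B \subset t :&: t') && (#|B| == 2)].
      by apply/setP=> B; rewrite !inE.
    by rewrite cards_draws bin_gt0.
  rewrite !inE subsetI -andbA => /and3P[et et' e2].
  move/negP: (ncov e et e2); apply; rewrite /covered e2 /=.
  by apply/existsP; exists t'; rewrite Pt'.
have tP : t \in P.
  rewrite -(maxP (t |: P)) ?setU11 ?subsetUr //; apply/andP; split.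
    apply/edge_disjointP=> t1 t2; rewrite !inE.
    case/predU1P=> [->|P1]; case/predU1P=> [->|P2]; rewrite ?eqxx //.
    - by move=> _; apply: small.
    - by move=> _; rewrite setIC; apply: small.
    - exact: disjP.
  apply/forall_inP=> t'; rewrite !inE => /predU1P[->|/triP//].
  rewrite /triangle ct eqxx; apply/forall_inP=> e /andP[et /eqP e2].
  by case: (pair_sub_set3 et e2) => ->.
by move: (small t tP); rewrite setIid ct.
Qed.

(** * Counting the colourings with no surviving backward arc *)

Variable k : nat.
Implicit Type f : {ffun 'I_k -> V}.

(** Only these triples can cover a pair inside [S]; restricting packings to them keeps the number of
    families in the union bound small. *)
Definition touching S := [set t : {set V} | (#|t| == 3) && (1 < #|t :&: S|)].

(* If P is the set of packed triangles meeting the range of f in a pair, and every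
   surviving arc inside that range goes forward along f, then each pair e has an
   allowed colour; these conditions involve distinct pairs, so they are independent. *)
Definition allowed f P e : pred colour := fun c =>
  if covered P e then present c else
  [forall i : 'I_k, forall j : 'I_k, (i < j) && (e == [set f i; f j]) ==>
     (c != inl (f j < f i))].

(** A backward arc inside the range of [f] must have been deleted, hence is covered by some [t] of
    [P]; this [t] meets the range in that pair, so the restriction of [P] still covers it. *)
Lemma bad_family f w P : injective f -> packing w P ->
  (forall i j : 'I_k, i < j -> ~~ pruned w P (f j) (f i)) ->
  w \in family (allowed f (P :&: touching (f @: setT))).
Proof.
move=> injf /andP[_ /forall_inP triP] bad; apply/familyP=> e.
rewrite unfold_in /allowed; case: ifPn => [|ncov].
  case/andP=> e2 /existsP[t /andP[]]; rewrite !inE => /andP[Pt _] et.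
  by have /andP[_ /forall_inP] := triP _ Pt; apply; rewrite et.
apply/forallP=> i; apply/forallP=> j; apply/implyP=> /andP[ij /eqP eE].
apply/negP=> /eqP wE; move: (bad i j ij); rewrite /pruned /arc /=.
have fij : f j != f i by apply: contraTneq ij => /injf->; rewrite ltnn.
have e2 : #|e| = 2 by rewrite eE cards2 eq_sym fij.
rewrite fij setUC -eE wE eqxx /= negbK => /andP[_ /existsP[t /andP[Pt et]]].
case/negP: ncov; rewrite /covered e2 /=; apply/existsP; exists t.
rewrite et andbT !inE Pt; have /andP[-> _] /= := triP _ Pt.
rewrite -e2; apply: subset_leq_card; rewrite subsetI et eE.
by apply/subsetP=> v /set2P[] ->; apply: imset_f.
Qed.

(** Each such triple is a pair of [S] together with one further vertex. *)
Lemma card_touching S : #|touching S| <= 'C(#|S|, 2) * n.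
Proof.
pose g (u : {set V} * V) := u.2 |: u.1.
have := leq_imset_card g (setX [set B : {set V} | (B \subset S) && (#|B| == 2)] setT).
rewrite cardsX cards_draws cardsT card_ord; apply: leq_trans; apply: subset_leq_card.
apply/subsetP=> t; rewrite inE => /andP[/eqP t3 tS].
have [e] : exists e, e \in [set B : {set V} | (B \subset t :&: S) && (#|B| == 2)].
  by apply/set0Pn; rewrite -card_gt0 cards_draws bin_gt0.
rewrite inE subsetI -andbA => /and3P[et eS /eqP e2].
have /cards1P[v vE] : #|t :\: e| == 1.
  by rewrite cardsD (setIidPr et) t3 e2.
apply/imsetP; exists (e, v); first by rewrite !inE eS e2.
by rewrite /g /= -vE setUC -{1}(setID t e) (setIidPr et).
Qed.

Lemma card_allowed_covered f P e :
  covered P e -> #|allowed f P e| <= 2.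
Proof.
move=> cov; apply: leq_trans (_ : #|pred2 (inl true : colour) (inl false)| <= 2).
  apply: subset_leq_card; apply/subsetP=> c; rewrite !unfold_in /allowed cov.
  by case: c => // -[].
by rewrite card2.
Qed.

Lemma card_colour : #|{: colour}| = m.+2.
Proof. by rewrite card_sum card_bool card_ord. Qed.

Lemma card_allowed_inside f P e : injective f -> ~~ covered P e ->
  #|e| = 2 -> e \subset f @: setT -> #|allowed f P e| <= m.+1.
Proof.
move=> injf ncov /eqP/cards2P[a [b [ab eE]]]; subst e; rewrite subUset !sub1set => /andP[/imsetP[i _ ai] /imsetP[j _ bj]].
wlog ij : a b i j ab ai bj ncov / i < j.
  move=> H; case: (ltngtP i j) => [||/ord_inj ij]; first exact: H ab ai bj ncov.
    by rewrite setUC in ncov *; apply: H bj ai ncov; rewrite eq_sym.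
  by rewrite ai bj ij eqxx in ab.
apply: leq_trans (_ : #|predC1 (inl (f j < f i) : colour)| <= _); last first.
  by rewrite cardC1 card_colour.
apply: subset_leq_card; apply/subsetP=> c; rewrite !unfold_in /allowed.
rewrite (negbTE ncov) => /forallP/(_ i)/forallP/(_ j).
by rewrite ij ai bj eqxx.
Qed.

Local Open Scope ring_scope.
Variable R : realFieldType.

(** By edge-disjointness the last product has at most one factor. The factor [m.+1 / m.+2] is
    charged to covered inside pairs too, so that its total exponent does not depend on [P]; the
    price is [2 / m.+1] instead of [2 / m.+2] for a covered pair. *)
Lemma card_allowed f P e : injective f -> edge_disjoint P ->
  (#|allowed f P e|%:R : R) <=
  m.+2%:R * (if (e \subset f @: setT) && (#|e| == 2) then m.+1%:R / m.+2%:R else 1)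
    * \prod_(t in P | (e \subset t) && (#|e| == 2)) (2 / m.+1%:R).
Proof.
move=> injf /edge_disjointP disj.
have q0 : 0 < m.+1%:R :> R by rewrite ltr0n.
have Q0 : 0 < m.+2%:R :> R by rewrite ltr0n.
have qQ : m.+1%:R <= m.+2%:R :> R by rewrite ler_nat.
have Qa : m.+2%:R * (m.+1%:R / m.+2%:R) = m.+1%:R :> R.
  by rewrite mulrC divfK ?lt0r_neq0.
have [cov|ncov] := boolP (covered P e).
  apply: (@le_trans _ _ 2); first by rewrite (ler_nat R _ 2) card_allowed_covered.
  case/andP: cov => e2 /existsP[t /andP[Pt et]].
  rewrite (big_pred1 t) => [|t' /=].
    rewrite e2 andbT; case: ifP => _.
      by rewrite Qa mulrC divfK ?lt0r_neq0.
    by rewrite mulr1 mulrCA ler_peMr // ler_pdivlMr // mul1r.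
  rewrite e2 andbT; apply/andP/eqP => [[Pt' et']|->//].
  have [//|tt'] := eqVneq t' t.
  have := disj _ _ Pt' Pt tt'; rewrite leqNgt => /negP[].
  by rewrite -(eqP e2); apply: subset_leq_card; rewrite subsetI et'.
rewrite big_pred0 => [|t]; last first.
  apply/negP=> /and3P[Pt et e2]; case/negP: ncov; rewrite /covered e2.
  by apply/existsP; exists t; rewrite Pt.
rewrite mulr1; case: ifP => [/andP[eS /eqP e2]|_].
  by rewrite Qa ler_nat card_allowed_inside.
by rewrite mulr1 ler_nat -card_colour max_card.
Qed.

Lemma card_family_allowed f P : injective f -> edge_disjoint P ->
  P \subset touching (f @: setT) ->
  (#|family (allowed f P)|%:R : R) <=
  m.+2%:R ^+ #|{set V}| * (m.+1%:R / m.+2%:R) ^+ 'C(k, 2)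
    * ((2 / m.+1%:R) ^+ 3) ^+ #|P|.
Proof.
move=> injf disj /subsetP PS.
have cS : #|f @: setT| = k by rewrite card_imset // cardsT card_ord.
rewrite card_family foldrE big_map big_enum natr_prod.
apply: le_trans.
  apply: ler_prod => e _; rewrite ler0n /=.
  exact: (card_allowed e injf disj).
rewrite !big_split /= prodr_const -big_mkcond /=.
(* Regroup the covered pairs by triangle: each contains ['C(3, 2) = 3] pairs, whence the cube. *)
rewrite (exchange_big_dep (mem P)) //=; last by move=> e t _ /andP[].
rewrite -[X in 'C(X, _)]cS -cards_draws.
have -> (x : R) : \prod_(i : {set V} | (i \subset f @: setT) && (#|i| == 2%N)) x
  = x ^+ #|[set B : {set V} | (B \subset f @: setT) && (#|B| == 2%N)]|.
  by rewrite -prodr_const; apply: eq_bigl => e; rewrite inE.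
rewrite -[_ ^+ #|P|]prodr_const le_eqVlt; apply/orP; left; apply/eqP; congr (_ * _).
apply: eq_bigr => t Pt; have := PS t Pt; rewrite inE => /andP[/eqP t3 _].
rewrite Pt /= -[3%N]/('C(3, 2)) -[X in 'C(X, _)]t3 -cards_draws -prodr_const.
by apply: eq_bigl => e; rewrite inE.
Qed.

(** Quantifying over all packings lets a maximal one be chosen after the colouring. *)
Definition good w := forall f P, injective f -> packing w P ->
  exists i j : 'I_k, (i < j)%N /\ pruned w P (f j) (f i).

(* Union bound over the enumerations f and the packings P. *)
Lemma exists_good :
  n%:R ^+ k * (m.+1%:R / m.+2%:R) ^+ 'C(k, 2)
    * (1 + (2 / m.+1%:R) ^+ 3) ^+ ('C(k, 2) * n) < 1 :> R ->
  exists w, good w.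
Proof.
set a := m.+1%:R / m.+2%:R; set x := (2 / m.+1%:R) ^+ 3 => small.
apply: contrapT => nogood.
pose bad (u : {ffun 'I_k -> V} * {set {set V}}) := [&& injectiveb u.1,
  edge_disjoint u.2 & u.2 \subset touching (u.1 @: setT)].
have cover w : exists2 u, bad u & w \in family (allowed u.1 u.2).
  have : ~ good w by move=> gw; apply: nogood; exists w.
  move/existsNP=> [f] /existsNP[P] /not_implyP[injf] /not_implyP[pack nex].
  exists (f, P :&: touching (f @: setT)) => /=.
    apply/and3P; split; [exact/injectiveP | | exact: subsetIr].
    case/andP: pack => /edge_disjointP disj _; apply/edge_disjointP => t1 t2.
    by move=> /setIP[P1 _] /setIP[P2 _]; apply: disj.
  apply: bad_family => // i j ij; apply/negP=> ji; apply: nex.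
  by exists i, j.
have : (#|{: colouring}| <= \sum_(u | bad u) #|family (allowed u.1 u.2)|)%N.
  rewrite -sum1_card.
  under [X in (_ <= X)%N]eq_bigr do rewrite -sum1_card big_mkcond.
  rewrite exchange_big /=; apply: leq_sum => w _.
  by have [u bu wu] := cover w; rewrite (bigD1 u) //= wu.
rewrite card_ffun card_colour -(ler_nat R) natr_sum natrX => le1.
have Q0 : 0 < m.+2%:R ^+ #|{set V}| :> R by rewrite exprn_gt0 // ltr0n.
have x0 : 0 <= x by rewrite exprn_ge0 // divr_ge0 ?ler0n.
have a0 : 0 <= a by rewrite divr_ge0 ?ler0n.
suff : \sum_(u | bad u) (#|family (allowed u.1 u.2)|%:R : R) <=
  m.+2%:R ^+ #|{set V}| * (n%:R ^+ k * a ^+ 'C(k, 2) * (1 + x) ^+ ('C(k, 2) * n)).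
  move=> /(le_trans le1); rewrite -{1}[_ ^+ #|_|]mulr1 ler_pM2l // => /(lt_le_trans small).
  by rewrite ltxx.
pose b f P := [&& injectiveb f, edge_disjoint P & P \subset touching (f @: setT)].
rewrite -(pair_big_dep xpredT b (fun f P => #|family (allowed f P)|%:R)) /=.
apply: (@le_trans _ _ (\sum_(f : {ffun 'I_k -> V}) m.+2%:R ^+ #|{set V}| *
   (a ^+ 'C(k, 2) * (1 + x) ^+ ('C(k, 2) * n)))); last first.
  rewrite sumr_const card_ffun !card_ord -[X in X <= _]mulr_natr natrX.
  by rewrite -mulrA [X in _ * X]mulrC !mulrA.
apply: ler_sum => f _.
have [injf|ninj] := boolP (injectiveb f); last first.
  rewrite big_pred0 => [|P]; last by rewrite /b (negbTE ninj).
  by apply: mulr_ge0 (ltW Q0) (mulr_ge0 _ _); apply: exprn_ge0; rewrite ?addr_ge0.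
(* Dropping edge-disjointness only adds nonnegative terms, and the sum over all subsets has a closed
   form. *)
apply: (@le_trans _ R (\sum_(P : {set {set V}} | P \subset touching (f @: setT))
    m.+2%:R ^+ #|{set V}| * (a ^+ 'C(k, 2) * x ^+ #|P|))).
  rewrite /b [X in _ <= X](bigID (@edge_disjoint)) /= injf /=.
  rewrite -[X in X <= _]addr0; apply: lerD; last first.
    apply: sumr_ge0 => P _; apply: mulr_ge0 (ltW Q0) (mulr_ge0 _ _).
      exact: exprn_ge0.
    exact: exprn_ge0.
  rewrite (eq_bigl _ _ (fun P => andbC _ _)); apply: ler_sum => P /andP[PS disj].
  by rewrite mulrA; apply: card_family_allowed => //; apply/injectiveP.
rewrite -!mulr_sumr sum_expr_card_subsets ler_pM2l // ler_wpM2l ?exprn_ge0 //.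
apply: ler_weXn2l; first by rewrite lerDl.
apply: leq_trans (card_touching _) _.
by rewrite card_imset ?cardsT ?card_ord //; apply/injectiveP.
Qed.

End Model.

(** * From a good colouring to a digraph *)

Lemma good_acyclic_number n m k (w : colouring n m) : good k w ->
  exists2 A : rel 'I_n, oriented_triangle_free A & acyclic_number A < k.
Proof.
move=> gw; have p0 : packing w set0.
  by apply/andP; split; [apply/edge_disjointP=> t1 t2|apply/forall_inP=> t];
    rewrite inE.
have [P maxP _] := maxset_exists p0.
exists (pruned w P).
  by split; [exact: oriented_pruned | exact: triangle_free_pruned].
(* For [k = 0] the empty enumeration would contradict goodness, which asks for indices in ['I_0]. *)
have kgt0 : 0 < k.
  rewrite lt0n; apply/negP=> /eqP k0; subst k.
  by have [|[]] := gw (ffun0 (card_ord 0)) P _ (maxsetp maxP); case.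
rewrite -(prednK kgt0) ltnS; apply/bigmax_leqP=> S /asboolP acS.
rewrite -ltnS prednK // ltnNge; apply/negP=> kS.
have [f injf fwd] := acyclic_order acS kS.
have [i [j [ij ji]]] := gw f P injf (maxsetp maxP).
by have := fwd i j ij; rewrite ji.
Qed.

(** * Numerical estimates and choice of parameters *)

Local Open Scope ring_scope.

(* 5 sqrt n nearly maximises c (1/2 - c^2), where 2/q = c / sqrt n. *)
Lemma union_bound_lt1 (R : realType) (n k q : nat) :
  let s := Num.sqrt (n%:R : R) in
  (400 <= n)%N -> 5 * s <= q%:R -> q%:R <= 5 * s + 1 ->
  107 / 8 * s * log2 (n%:R : R) < k%:R ->
  n%:R ^+ k * (q%:R / q.+1%:R) ^+ 'C(k, 2)
    * (1 + (2 / q%:R) ^+ 3) ^+ ('C(k, 2) * n) < 1 :> R.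
Proof.
move=> s n_ge q_ge q_le.
have n_geR : 400 <= n%:R :> R by rewrite (ler_nat R 400).
have n0 : 0 < n%:R :> R by lra.
have s2 : s ^+ 2 = n%:R by rewrite sqr_sqrtr // ltW.
have s_ge : 20 <= s.
  by rewrite -(@ler_pXn2r _ 2) ?nnegrE ?sqrtr_ge0 // s2; lra.
have q0 : 0 < q%:R :> R by lra.
pose X := ln (n%:R : R).
have nE : n%:R = expR X by rewrite lnK.
have X_ge : 1 / 2 <= X.
  rewrite -ler_expR -nE; apply: le_trans n_geR.
  have := expR_ge1Dx (- (1 / 2) : R); rewrite expRN => h.
  have e0 := expR_gt0 (1 / 2 : R).
  have : (expR (1 / 2 : R))^-1 * expR (1 / 2) = 1 by rewrite mulVf ?gt_eqF.
  nra.
(* [expR (3 / 4)] is the sixth power of [expR (1 / 8)], and [(9 / 8) ^+ 6 > 2]. *)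
have ln2_le : ln (2 : R) <= 3 / 4.
  rewrite -ler_expR lnK ?posrE //.
  have -> : 3 / 4 = 6%:R * (1 / 8) :> R by lra.
  rewrite expRM_natl; have h : 9 / 8 <= expR (1 / 8 : R).
    by have := expR_ge1Dx (1 / 8 : R); lra.
  apply: le_trans (lerXn2r 6 _ _ h); rewrite ?nnegrE ?expR_ge0 //; lra.
have ln2_gt0 : 0 < ln (2 : R) by rewrite ln_gt0 // ltr1n.
rewrite /log2 -/X mulrA ltr_pdivrMr // => k_gt.
(* Dividing [107 / 8] by [3 / 4] gives [107 / 6 > 17]; the surplus, at least [5 / 6 * 10], absorbs
   the [1]. *)
have k_ge : 17 * (s * X) + 1 <= k%:R.
  have sX : 10 <= s * X.
    by apply: le_trans (ler_pM _ _ s_ge X_ge); rewrite ?ler0n //; lra.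
  have : k%:R * ln 2 <= k%:R * (3 / 4) :> R by rewrite ler_wpM2l.
  lra.
pose d : R := q.+1%:R^-1 - n%:R * (2 / q%:R) ^+ 3.
have s_gt0 : 0 < s by lra.
(* As [s >= 20], [q + 1 <= 5 s + 2 <= s / 0.194]; and [q >= 5 s] gives
   [8 n / q ^ 3 <= 0.064 / s]. *)
have d_ge : 13 / 100 / s <= d.
  have h1 : 194 / 1000 / s <= q.+1%:R^-1.
    rewrite ler_pdivrMr // [leRHS]mulrC ler_pdivlMr ?ltr0n // -natr1; lra.
  have h2 : n%:R * (2 / q%:R) ^+ 3 <= 64 / 1000 / s.
    rewrite -s2 expr_div_n mulrA ler_pdivrMr ?exprn_gt0 //.
    have -> : s ^+ 2 * 2 ^+ 3 = 64 / 1000 / s * (5 * s) ^+ 3.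
      by field; rewrite gt_eqF.
    rewrite ler_pM2l ?divr_gt0 //.
    by rewrite lerXn2r ?nnegrE ?(ltW q0) ?mulr_ge0 ?(ltW s_gt0).
  rewrite /d; have -> : 13 / 100 / s = 130 / 1000 / s :> R by field; rewrite gt_eqF.
  have -> : 130 / 1000 / s = 194 / 1000 / s - 64 / 1000 / s :> R.
    by field; rewrite gt_eqF.
  exact: lerB.
have C_E : 'C(k, 2)%:R = k%:R * (k%:R - 1) / 2 :> R.
  elim: k {k_gt k_ge} => [|k IHk]; first by rewrite bin0n !mul0r.
  by rewrite binS bin1 natrD IHk -natr1; field.
have a_le : q%:R / q.+1%:R <= expR (- q.+1%:R^-1) :> R.
  apply: le_trans (expR_ge1Dx _).
  have -> : q%:R = q.+1%:R - 1 :> R by rewrite -natr1 addrK.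
  by rewrite mulrBl mul1r divff ?pnatr_eq0.
have b_le := expR_ge1Dx ((2 / q%:R : R) ^+ 3).
have x_ge0 : 0 <= (2 / q%:R : R) ^+ 3 by rewrite exprn_ge0 // divr_ge0 ?ltW.
(* Both bases are bounded by [1 + y <= expR y]. *)
apply: (@le_lt_trans _ _ (expR (k%:R * X - 'C(k, 2)%:R * d))).
  have -> : k%:R * X - 'C(k, 2)%:R * d = k%:R * X + 'C(k, 2)%:R * - q.+1%:R^-1
      + ('C(k, 2) * n)%:R * (2 / q%:R) ^+ 3.
    by rewrite /d natrM; ring.
  rewrite !expRD !expRM_natl -nE.
  apply: ler_pM; rewrite ?mulr_ge0 ?exprn_ge0 ?divr_ge0 ?addr_ge0 //.
    rewrite ler_wpM2l ?exprn_ge0 // lerXn2r ?nnegrE ?expR_ge0 ?divr_ge0 //.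
  by rewrite lerXn2r ?nnegrE ?expR_ge0 ?addr_ge0.
rewrite expR_lt1 C_E.
(* The constants leave a margin: [17 / 2 * 13 / 100 = 221 / 200 > 1]. *)
have kX : X < (k%:R - 1) / 2 * d.
  have h : 17 * (s * X) / 2 * (13 / 100 / s) <= (k%:R - 1) / 2 * d.
    by apply: ler_pM => //; rewrite ?divr_ge0 ?mulr_ge0 //; lra.
  apply: lt_le_trans h.
  have -> : 17 * (s * X) / 2 * (13 / 100 / s) = 221 / 200 * X.
    by field; rewrite gt_eqF.
  lra.
have k0 : 0 < k%:R :> R.
  apply: lt_le_trans k_ge; rewrite ltr_wpDl ?mulr_ge0 ?(ltW s_gt0) //; lra.
rewrite subr_lt0 -!mulrA ltr_pM2l // mulrA.
exact: kX.
Qed.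

Theorem mainTheorem4 (R : realType) :
  (exists N : nat, forall n : nat, (N <= n)%N ->
     exists (T : finType) (A : rel T),
       [/\ #|T| = n, oriented_triangle_free A &
           (acyclic_number A)%:R <=
             107 / 8 * Num.sqrt (n%:R : R) * log2 (n%:R : R)])
  /\
  (exists N : nat, forall n : nat, (N <= n)%N ->
     (min_acyclic_number n)%:R <=
       107 / 8 * Num.sqrt (n%:R : R) * log2 (n%:R : R)).
Proof.
have main n : (400 <= n)%N -> exists (T : finType) (A : rel T),
  [/\ #|T| = n, oriented_triangle_free A &
    (acyclic_number A)%:R <=
      107 / 8 * Num.sqrt (n%:R : R) * log2 (n%:R : R)].
  move=> n_ge; set B := _ * log2 _.
  have s0 : 0 < Num.sqrt (n%:R : R).
    by rewrite sqrtr_gt0 ltr0n (leq_trans _ n_ge).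
  have B0 : 0 <= B.
    have n_gt0 : (0 < n)%N by apply: leq_trans n_ge.
    by rewrite /B /log2 !mulr_ge0 ?invr_ge0 ?(ltW s0) ?ln_ge0 ?ler1n ?ler0n.
  (* With this [m], the value [q = m.+1] lies between [5 s] and [5 s + 1]. *)
  pose m := Num.truncn (5 * Num.sqrt (n%:R : R)).
  have /andP[m_le m_gt] := truncn_itv (mulr_ge0 (ler0n R 5) (ltW s0)).
  (* The least integer above [B]: an acyclic number below [k] is at most [Num.truncn B], hence at
     most [B]. *)
  pose k := (Num.truncn B).+1.
  have /andP[k_le] := truncn_itv B0; rewrite -/k => k_gt.
  have [|w gw] := @exists_good n m k R.
    apply: union_bound_lt1 => //; first exact: ltW.
    by rewrite -natr1 lerD2r.
  have [A otfA A_lt] := good_acyclic_number gw.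
  exists 'I_n, A; split=> //; first exact: card_ord.
  by apply: le_trans k_le; rewrite ler_nat -ltnS.
split; exists 400%N => // n /main[T [A [cT otfA le_A]]].
apply: le_trans le_A; rewrite ler_nat /min_acyclic_number.
case: ex_minnP => a _; apply; apply/asboolP.
by exists T, A.
Qed.
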